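(* Fix $E_{\rm c}>0$, $T>0$ and an initial vector $\Phi^0\in\mathbb{C}^{|\mathcal{I}_{E_{\rm c}}|}$. Let $H=D+V^1+V^2$ be the plane wave Hamiltonian matrix with energy cutoff $E_{\rm c}$ of the two-layer incommensurate system, and let $\Phi(t)$ be the solution of $$\frac{\mathrm{d}\Phi(t)}{\mathrm{d}t}=-iH\Phi(t),\qquad \Phi(0)=\Phi^0 .$$ For a time step $\tau>0$ let $\Phi^k$ be obtained from $\Phi^0$ by the Crank–Nicolson based operator splitting scheme, for $k=0,1,2,\dots$, $$\frac{\Phi^{k+1/3}-\Phi^{k}}{\tau/2}=-i\Big(\tfrac12D+V^1\Big)\frac{\Phi^{k+1/3}+\Phi^{k}}{2},$$ $$\frac{\Phi^{k+2/3}-\Phi^{k+1/3}}{\tau}=-i\Big(\tfrac12D+V^2\Big)\frac{\Phi^{k+2/3}+\Phi^{k+1/3}}{2},$$ $$\frac{\Phi^{k+1}-\Phi^{k+2/3}}{\tau/2}=-i\Big(\tfrac12D+V^1\Big)\frac{\Phi^{k+1}+\Phi^{k+2/3}}{2}.$$ Then there exist positive constants $\tau_0$ and $C_T$ (with $C_T$ depending on $T$ but independent of $\tau$) such that $$\|\Phi(t_k)-\Phi^k\|_{\ell_2}\leq C_T\,\tau^2$$ for any time step $0<\tau<\tau_0$ and every $t_k=k\tau\in[0,T]$.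
   Context: Let $d\in\{1,2\}$ and let $A_1,A_2\in\mathbb{R}^{d\times d}$ be invertible. For $j=1,2$ put $\mathcal{R}_j=\{A_jn:n\in\mathbb{Z}^d\}$, $\Gamma_j=\{A_j\alpha:\alpha\in[0,1)^d\}$, $\mathcal{R}_j^*=\{2\pi A_j^{-T}n:n\in\mathbb{Z}^d\}$ and $G_{jm}=2\pi A_j^{-T}m$ for $m\in\mathbb{Z}^d$. The lattices are assumed incommensurate: for $\gamma\in\mathbb{R}^d$, $\gamma+(\mathcal{R}_1^*\cup\mathcal{R}_2^* )=\mathcal{R}_1^*\cup\mathcal{R}_2^*$ if and only if $\gamma=0$. For $j=1,2$, $v_j\in L^2_{\rm loc}(\mathbb{R}^d)$ is a real-valued $\mathcal{R}_j$-periodic potential, with Fourier coefficients $\hat v^{(j)}_m=\frac{1}{|\Gamma_j|}\int_{\Gamma_j}v_j(x)e^{-iG_{jm}\cdot x}\,\mathrm{d}x$, $m\in\mathbb{Z}^d$. For an energy cutoff $E_{\rm c}>0$ let $\mathcal{I}^{j}_{E_{\rm c}}=\{m\in\mathbb{Z}^d:|G_{jm}|^2\le 2E_{\rm c}\}$ ($j=1,2$) and $\mathcal{I}_{E_{\rm c}}=\mathcal{I}^1_{E_{\rm c}}\times\mathcal{I}^2_{E_{\rm c}}$, a finite set. Vectors in $\mathbb{C}^{|\mathcal{I}_{E_{\rm c}}|}$ are indexed by $(m,n)\in\mathcal{I}_{E_{\rm c}}$. The matrices $D,V^1,V^2\in\mathbb{C}^{|\mathcal{I}_{E_{\rm c}}|\times|\mathcal{I}_{E_{\rm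 c}}|}$ have entries, for $(m,n),(m',n')\in\mathcal{I}_{E_{\rm c}}$, $$D_{mn,m'n'}=\tfrac12|G_{1m}+G_{2n}|^2\delta_{mm'}\delta_{nn'},\quad V^1_{mn,m'n'}=\hat v^{(1)}_{m-m'}\delta_{nn'},\quad V^2_{mn,m'n'}=\hat v^{(2)}_{n-n'}\delta_{mm'}.$$ The matrix $H=D+V^1+V^2$ is Hermitian. *)

(* Defs.v *)
From HB Require Import structures.
From mathcomp Require Import all_boot all_order all_algebra finmap.
From mathcomp Require Import all_classical all_reals all_analysis.
From mathcomp Require Import complex zify.

Set Implicit Arguments.
Unset Strict Implicit.
Unset Printing Implicit Defensive.
Import Order.TTheory GRing.Theory Num.Theory.
Import numFieldNormedType.Exports.

Local Open Scope classical_set_scope.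
Local Open Scope ring_scope.
Local Open Scope complex_scope.

(* Lebesgue measure on R^d (column vectors): the Lebesgue outer measure is the
   infimum of the total volumes of countable covers by half-open boxes, and the
   measure is its restriction to the Caratheodory-measurable sets. *)
Section lebesgue_measure_Rd.
Variables (R : realType) (d : nat).
Notation V := 'cV[R]_d.

(* None is the empty box, so that finite covers are allowed in every dimension,
   including d = 0. *)
Definition box (c : option (V * V)) : set V :=
  if c is Some (a, b) then [set x | forall i, a i 0 <= x i 0 < b i 0]
  else set0.

Definition box_vol (c : option (V * V)) : R :=
  if c is Some (a, b) then \prod_i Num.max 0 (b i 0 - a i 0) else 0.

Definition leb_outer (X : set V) : \bar R :=
  ereal_inf [set (\sum_(k <oo) (box_vol (F k))%:E)%E |
             F in [set F : nat -> option (V * V) | X `<=` \bigcup_k box (F k)]].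

Local Open Scope ereal_scope.

Let box_vol_ge0 c : 0 <= (box_vol c)%:E.
Proof.
rewrite lee_fin; case: c => [[a b]|] //=.
by apply: prodr_ge0 => i _; rewrite le_max lexx.
Qed.

Let leb_outer_ge0 X : 0 <= leb_outer X.
Proof. by apply: le_ereal_inf_tmp => _ [F _ <-]; apply: nneseries_ge0. Qed.

Let leb_outer0 : leb_outer set0 = 0.
Proof.
apply/eqP; rewrite eq_le leb_outer_ge0 andbT.
apply: ereal_inf_lbound; exists (fun=> None) => //.
by apply: eseries0.
Qed.

Let le_leb_outer : {homo leb_outer : A B / A `<=` B >-> A <= B}.
Proof.
move=> A B AB; apply/ereal_inf_le_tmp => x [F BF <-].
by exists F => //; apply: subset_trans AB BF.
Qed.

Let leb_outer_sigma_subadditive : sigma_subadditive leb_outer.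
Proof.
move=> A; have [[i ioo]|] := pselect (exists i, leb_outer (A i) = +oo).
  rewrite (eseries_pinfty _ _ ioo) ?leey// => n _.
  by rewrite -ltNye (lt_le_trans _ (leb_outer_ge0 _)).
rewrite -forallNE => Aoo.
suff add2e (e : {posnum R}) :
    leb_outer (\bigcup_n A n) <= \sum_(i <oo) leb_outer (A i) + e%:num%:E.
  by apply/lee_addgt0Pr => _/posnumP[].
rewrite (le_trans _ (epsilon_trick _ _ _))//.
pose P n (B : nat -> option (V * V)) := A n `<=` \bigcup_k box (B k) /\
  \sum_(k <oo) (box_vol (B k))%:E
    <= leb_outer (A n) + (e%:num / (2 ^ n.+1)%:R)%:E.
have [G PG] : {G : nat -> nat -> option (V * V) & forall n, P n (G n)}.
  apply: (@choice _ _ P) => n; rewrite /P /leb_outer.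
  set S := (X in ereal_inf X); move infS : (ereal_inf S) => iS.
  case: iS infS => [r Sr|Soo|Soo].
  - have en1 : (0 < e%:num / (2 ^ n.+1)%:R :> R)%R by [].
    have /(lb_ereal_inf_adherent en1) : ereal_inf S \is a fin_num by rewrite Sr.
    by move=> [x [B AnB muBx] xS]; exists B; split => //; rewrite muBx -Sr ltW.
  - by have := Aoo n; rewrite /leb_outer Soo.
  - suff : lbound S 0 by move/le_ereal_inf_tmp; rewrite Soo.
    by move=> /= _ [B AnB <-]; exact: nneseries_ge0.
pose g (p : nat * nat) := (box_vol (G p.1 p.2))%:E.
have g_ge0 p : 0 <= g p by exact: box_vol_ge0.
apply: (@le_trans _ _ (\esum_(i in [set: nat * nat]) g i)).
  apply: ereal_inf_lbound => /=.
  have /card_esym/ppcard_eqP[f] := card_nat2.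
  exists (fun k => G (f k).1 (f k).2).
    move=> t [i _] /((PG i).1) [j _ Bijt].
    by exists (f^-1%FUN (i, j)) => //=; rewrite invK ?inE.
  rewrite -[LHS]/(\sum_(k <oo) g (f k)).
  rewrite -(esum_pred_image g f xpredT) ?[fun=> _]set_true//.
  by rewrite image_eq.
have -> : \esum_(i in [set: nat * nat]) g i = \sum_(i <oo) \sum_(j <oo) g (i, j).
  pose J : nat -> set (nat * nat) := fun i => [set (i, j) | j in setT].
  rewrite (_ : setT = \bigcup_k J k); last first.
    by rewrite predeqE => -[a b]; split => // _; exists a => //; exists b.
  rewrite esum_bigcupT//; last first.
    apply/trivIsetP => i j _ _ ij.
    rewrite predeqE => -[n m] /=; split => //= -[] [_] _ [<-{n} _].
    by move=> [m' _] [] /esym/eqP; rewrite (negbTE ij).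
  rewrite -(image_id [set: nat]) -fun_true esum_pred_image//; last first.
    by move=> n _; exact: esum_ge0.
  apply: eq_eseriesr => /= j _.
  rewrite -(esum_pred_image g (pair j) predT)//=; last first.
    by move=> ? ? _ _; exact: (@can_inj _ _ _ snd).
  by congr esum; rewrite predeqE => -[a b]; split; move=> [i _ <-]; exists i.
apply: lee_nneseries => [n _|n _]; last exact: (PG n).2.
by move=> _; apply: nneseries_ge0.
Qed.

HB.instance Definition _ := isOuterMeasure.Build R V leb_outer
  leb_outer0 leb_outer_ge0 le_leb_outer leb_outer_sigma_subadditive.

Definition leb : set (caratheodory_type leb_outer) -> \bar R := leb_outer.

HB.instance Definition _ := Measure.copy leb
  ((leb_outer : {outer_measure set V -> \bar R}) :
    set (caratheodory_type leb_outer) -> \bar R).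

End lebesgue_measure_Rd.

Arguments leb {R d}.

Section layers.
Variables (R : realType) (d : nat).
Implicit Types (A : 'M[R]_d) (x y : 'cV[R]_d) (m : 'cV[int]_d).

Definition dotv x y : R := \sum_i x i 0 * y i 0.

Definition intv m : 'cV[R]_d := map_mx intr m.

Definition unit_cell A : set 'cV[R]_d :=
  [set A *m a | a in [set a : 'cV[R]_d | forall i, 0 <= a i 0 < 1]].

Definition recip A m : 'cV[R]_d := (2 * pi) *: ((invmx A)^T *m intv m).

Definition recip_lattice A : set 'cV[R]_d := range (recip A).

Definition incommensurate A1 A2 : Prop :=
  let L := recip_lattice A1 `|` recip_lattice A2 in
  forall gamma : 'cV[R]_d, [set gamma + x | x in L] = L <-> gamma = 0.

Definition L2loc (v : 'cV[R]_d -> R) : Prop :=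
  measurable_fun setT (v : caratheodory_type (@leb_outer R d) -> R) /\
  forall K : set 'cV[R]_d, compact K ->
    (\int[leb]_(x in K) (v x ^+ 2)%:E < +oo)%E.

(* Periodicity is required almost everywhere, L^2_loc functions being defined
   up to null sets. *)
Definition lattice_periodic A (v : 'cV[R]_d -> R) : Prop :=
  forall m, {ae leb, forall x, v (x + A *m intv m) = v x}.

Definition expi (t : R) : R[i] := cos t +i* sin t.

Definition cintegral (X : set 'cV[R]_d) (f : 'cV[R]_d -> R[i]) : R[i] :=
  (\int[leb]_(x in X) complex.Re (f x)) +i*
  (\int[leb]_(x in X) complex.Im (f x)).

Definition fourier_coef A (v : 'cV[R]_d -> R) m : R[i] :=
  ((fine (leb (unit_cell A)))^-1)%:C *
  cintegral (unit_cell A) (fun x => (v x)%:C * expi (- dotv (recip A m) x)).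

Definition cutoff A (Ec : R) : set 'cV[int]_d :=
  [set m | dotv (recip A m) (recip A m) <= 2 * Ec].

(* Needed for pw_index below: fset_set is only meaningful on finite sets. *)
Lemma finite_cutoff A Ec : A \in unitmx -> finite_set (cutoff A Ec).
Proof.
move=> Au; pose s := Num.sqrt (2 * Ec).
pose M := \sum_i \sum_j `|A j i| * s / (2 * pi).
have pi2 : 0 < 2 * pi :> R by rewrite mulr_gt0// pi_gt0.
pose B := Num.bound M.
pose f (k : 'cV['I_(B + B).+1]_d) : 'cV[int]_d :=
  map_mx (fun j : 'I_(B + B).+1 => j%:Z - B%:Z) k.
suff sub : cutoff A Ec `<=` f @` [set: 'cV['I_(B + B).+1]_d].
  by apply: sub_finite_set sub _; apply: finite_image; exact: finite_finset.
move=> m /=; set g := recip A m => gE.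
have gs i : `|g i 0| <= s.
  rewrite -(sqrtr_sqr (g i 0)) ler_wsqrtr// (le_trans _ gE)// /dotv -/g.
  by rewrite (bigD1 i)//= expr2 lerDl sumr_ge0// => j _; rewrite -expr2 sqr_ge0.
have mE : intv m = (2 * pi)^-1 *: (A^T *m g).
  rewrite /g /recip -scalemxAr scalerA mulVf ?gt_eqF// scale1r mulmxA.
  by rewrite -trmx_mul mulVmx// trmx1 mul1mx.
have mM i : `|intv m i 0| <= M.
  rewrite mE !mxE normrM gtr0_norm ?invr_gt0//.
  apply: (@le_trans _ _ (\sum_j `|A j i| * s / (2 * pi))).
    rewrite mulrC -mulr_suml ler_wpM2r ?invr_ge0 ?(ltW pi2)//.
    apply: le_trans (ler_norm_sum _ _ _) _; apply: ler_sum => j _.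
    by rewrite mxE normrM ler_wpM2l.
  rewrite /M [leRHS](bigD1 i)//= lerDl sumr_ge0// => k _; apply: sumr_ge0 => j _.
  by rewrite divr_ge0 ?(ltW pi2)// mulr_ge0// sqrtr_ge0.
have mB i : `|m i 0| <= B%:Z.
  rewrite -(ler_int R) intr_norm (le_trans _ (ltW (archi_boundP _)))//.
    by have := mM i; rewrite mxE.
  by apply: le_trans (mM i).
exists (\col_i inord (absz (m i 0 + B%:Z))) => //.
apply/colP => i; rewrite !mxE inordK.
  by have := mB i; lia.
by have := mB i; lia.
Qed.

Definition pw_index A1 A2 (Ec : R) : {fset 'cV[int]_d * 'cV[int]_d} :=
  fset_set (cutoff A1 Ec `*` cutoff A2 Ec).

Lemma in_pw_index A1 A2 Ec p : A1 \in unitmx -> A2 \in unitmx ->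
  (p \in pw_index A1 A2 Ec) =
  (dotv (recip A1 p.1) (recip A1 p.1) <= 2 * Ec) &&
  (dotv (recip A2 p.2) (recip A2 p.2) <= 2 * Ec).
Proof.
move=> A1u A2u; rewrite in_fset_set; last first.
  by apply: finite_setX; exact: finite_cutoff.
by apply/idP/andP; rewrite inE.
Qed.

Definition pw_dim A1 A2 Ec : nat := #|{: pw_index A1 A2 Ec}|.

Definition pw_label A1 A2 Ec (i : 'I_(pw_dim A1 A2 Ec)) :
  'cV[int]_d * 'cV[int]_d := val (enum_val i).

Section hamiltonian.
Variables (A1 A2 : 'M[R]_d) (v1 v2 : 'cV[R]_d -> R) (Ec : R).
Notation N := (pw_dim A1 A2 Ec).

Definition pwD : 'M[R[i]]_N := \matrix_(i, j)
  let: (m, n) := pw_label i in let: (m', n') := pw_label j in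
  let g := recip A1 m + recip A2 n in
  (2^-1 * dotv g g)%:C * (m == m')%:R * (n == n')%:R.

Definition pwV1 : 'M[R[i]]_N := \matrix_(i, j)
  let: (m, n) := pw_label i in let: (m', n') := pw_label j in
  fourier_coef A1 v1 (m - m') * (n == n')%:R.

Definition pwV2 : 'M[R[i]]_N := \matrix_(i, j)
  let: (m, n) := pw_label i in let: (m', n') := pw_label j in
  fourier_coef A2 v2 (n - n') * (m == m')%:R.

Definition pwH : 'M[R[i]]_N := pwD + pwV1 + pwV2.

End hamiltonian.

End layers.

Section schemes.
Variables (R : realType) (N : nat).
Implicit Types (M D V : 'M[R[i]]_N) (u w : 'cV[R[i]]_N).

Definition l2norm u : R :=
  Num.sqrt (\sum_i ComplexField.Normc.normc (u i 0) ^+ 2).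

(* Derivative in the real variable t of a C^N-valued function, taken on the
   real and imaginary parts of each component. *)
Definition is_vderive (Phi : R -> 'cV[R[i]]_N) (t : R) w : Prop :=
  forall i, is_derive t 1 (fun s => complex.Re (Phi s i 0)) (complex.Re (w i 0)) /\
            is_derive t 1 (fun s => complex.Im (Phi s i 0)) (complex.Im (w i 0)).

Definition evolution M u (Phi : R -> 'cV[R[i]]_N) : Prop :=
  Phi 0 = u /\ forall t, is_vderive Phi t (- 'i *: (M *m Phi t)).

Definition cn_step (h : R) M u w : Prop :=
  (h^-1)%:C *: (w - u) = - 'i *: (M *m (2^-1 *: (w + u))).

Definition cn_splitting D V1 V2 (tau : R) u (Psi : nat -> 'cV[R[i]]_N) : Prop :=
  Psi 0%N = u /\
  forall k, exists w1 w2,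
    [/\ cn_step (tau / 2) (2^-1 *: D + V1) (Psi k) w1,
        cn_step tau (2^-1 *: D + V2) w1 w2 &
        cn_step (tau / 2) (2^-1 *: D + V1) w2 (Psi k.+1)].

End schemes.

(* Main.v *)
(* Each Crank-Nicolson substep is compared with the quadratic Taylor polynomial
   of the corresponding exponential: it agrees with it up to the cube of the
   step and amplifies earlier errors by a factor 1 + O(tau). By symmetry the
   composition of the three quadratic polynomials agrees up to O(tau^3) with the
   quadratic Taylor polynomial of exp(-i tau H), hence with the exact flow, so
   the global error obeys e_(k+1) <= (1 + L tau) e_k + q tau^3, and the discrete
   Gronwall inequality concludes. *)

Require Import Defs.
From mathcomp Require Import all_boot all_order all_algebra.
From mathcomp Require Import all_classical all_reals all_analysis.
From mathcomp Require Import complex ring lra.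
Set Implicit Arguments.
Unset Strict Implicit.
Unset Printing Implicit Defensive.
Import Order.TTheory GRing.Theory Num.Theory.
Import numFieldNormedType.Exports.
Local Open Scope ring_scope.

(** * Entrywise norms of complex matrices and vectors *)

Section entrywise_norm.
Variable R : realType.
Implicit Types (x : R) (z : R[i]).

(* Taking |Re z| + |Im z| instead of the modulus keeps all estimates on the
   real and imaginary parts, which is how [is_vderive] is stated. *)
Definition cnorm1 z : R := `|complex.Re z| + `|complex.Im z|.

Lemma cnorm1_ge0 z : 0 <= cnorm1 z.
Proof. exact: addr_ge0. Qed.

Lemma cnorm1D z1 z2 : cnorm1 (z1 + z2) <= cnorm1 z1 + cnorm1 z2.
Proof.
case: z1 z2 => [a b] [c d]; rewrite /cnorm1 /= addrACA.
by apply: lerD; exact: ler_normD.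
Qed.

Lemma cnorm1M z1 z2 : cnorm1 (z1 * z2) <= cnorm1 z1 * cnorm1 z2.
Proof.
case: z1 z2 => [a b] [c d]; rewrite /cnorm1 /=.
have le1 : `|a * c - b * d| <= `|a| * `|c| + `|b| * `|d|.
  by rewrite (le_trans (ler_normB _ _))// !normrM.
have le2 : `|a * d + b * c| <= `|a| * `|d| + `|b| * `|c|.
  by rewrite (le_trans (ler_normD _ _))// !normrM.
by rewrite (le_trans (lerD le1 le2))// mulrDl !mulrDr; lra.
Qed.

Lemma cnorm1Z x z : cnorm1 (x%:C%C * z) = `|x| * cnorm1 z.
Proof.
by case: z => a b; rewrite /cnorm1 /= !mul0r subr0 addr0 !normrM mulrDr.
Qed.

Lemma cnorm1_sum (I : Type) (r : seq I) (F : I -> R[i]) :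
  cnorm1 (\sum_(i <- r) F i) <= \sum_(i <- r) cnorm1 (F i).
Proof.
elim/big_rec2: _ => [|i y1 y2 _ le12]; first by rewrite /cnorm1 /= normr0 addr0.
by rewrite (le_trans (cnorm1D _ _))// lerD2l.
Qed.

(** One norm serves matrices of every shape, vectors included. It is far from sharp, but it is
    submultiplicative and dominates the l2 norm, which is enough when the dimension is fixed. *)
Definition mnorm {m n} (A : 'M[R[i]]_(m, n)) : R :=
  \sum_i \sum_j cnorm1 (A i j).

Lemma mnorm_ge0 m n (A : 'M[R[i]]_(m, n)) : 0 <= mnorm A.
Proof. by do 2!apply: sumr_ge0 => ? _; exact: cnorm1_ge0. Qed.

Lemma mnormD m n (A B : 'M[R[i]]_(m, n)) : mnorm (A + B) <= mnorm A + mnorm B.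
Proof.
rewrite /mnorm -big_split; apply: ler_sum => i _.
by rewrite -big_split; apply: ler_sum => j _; rewrite mxE cnorm1D.
Qed.

Lemma mnormZ x m n (A : 'M[R[i]]_(m, n)) :
  mnorm (x%:C%C *: A) = `|x| * mnorm A.
Proof.
rewrite /mnorm mulr_sumr; apply: eq_bigr => i _.
by rewrite mulr_sumr; apply: eq_bigr => j _; rewrite mxE cnorm1Z.
Qed.

Lemma mnormN m n (A : 'M[R[i]]_(m, n)) : mnorm (- A) = mnorm A.
Proof.
by rewrite -scaleN1r -(rmorphN1 (real_complex R)) mnormZ normrN1 mul1r.
Qed.

Lemma mnormB m n (A B : 'M[R[i]]_(m, n)) : mnorm (A - B) <= mnorm A + mnorm B.
Proof. by rewrite -(mnormN B) mnormD. Qed.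

Lemma mnorm0 m n : mnorm (0 : 'M[R[i]]_(m, n)) = 0.
Proof.
by rewrite -(scale0r 0) -(rmorph0 (real_complex R)) mnormZ normr0 mul0r.
Qed.

(** After exchanging the sums, each entry [A i j] is multiplied by the sum over row [j] of [B],
    which is at most the sum over all of [B]. *)
Lemma mnormM m n p (A : 'M[R[i]]_(m, n)) (B : 'M[R[i]]_(n, p)) :
  mnorm (A *m B) <= mnorm A * mnorm B.
Proof.
rewrite /mnorm mulr_suml; apply: ler_sum => i _; rewrite mulr_suml.
have le1 k : cnorm1 ((A *m B) i k) <= \sum_j cnorm1 (A i j) * cnorm1 (B j k).
  rewrite mxE (le_trans (cnorm1_sum _ _))//.
  by apply: ler_sum => j _; exact: cnorm1M.
rewrite (le_trans (ler_sum _ (fun k _ => le1 k)))// exchange_big.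
apply: ler_sum => j _; rewrite -mulr_sumr ler_wpM2l ?cnorm1_ge0//.
by rewrite (bigD1 j)//= lerDl sumr_ge0// => k _; apply: sumr_ge0 => ? _;
  exact: cnorm1_ge0.
Qed.

(** The modulus is at most |Re| + |Im|, and a sum of squares of nonnegative numbers is at most the
    square of their sum. This transfers the final estimate from [mnorm] to the l2 norm. *)
Lemma l2norm_le_mnorm n (u : 'cV[R[i]]_n) : l2norm u <= mnorm u.
Proof.
rewrite /l2norm -(ger0_norm (mnorm_ge0 u)) -sqrtr_sqr ler_wsqrtr//.
have -> : mnorm u = \sum_i cnorm1 (u i 0).
  by apply: eq_bigr => i _; rewrite big_ord1.
apply: (@le_trans _ _ (\sum_i cnorm1 (u i 0) ^+ 2)).
  apply: ler_sum => i _; case: (u i 0) => a b; rewrite /cnorm1 /=.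
  rewrite sqr_sqrtr ?addr_ge0 ?sqr_ge0// sqrrD !real_normK ?num_real//.
  by rewrite lerD2r lerDl mulrn_wge0// mulr_ge0.
(* Nonnegativity of the partial sums is carried through the induction, since it gives the sign of
   the cross term of the square. *)
have [] // : 0 <= \sum_i cnorm1 (u i 0) /\
  \sum_i cnorm1 (u i 0) ^+ 2 <= (\sum_i cnorm1 (u i 0)) ^+ 2.
elim/big_rec2: _ => [|i x y _ [y0 le_xy]]; first by rewrite expr0n.
have c0 := cnorm1_ge0 (u i 0); split; first exact: addr_ge0.
by rewrite [leRHS]sqrrD; have := mulr_ge0 c0 y0; lra.
Qed.

End entrywise_norm.

(** * Differential calculus for vector-valued functions of a real variable *)

Section derivatives.
Variables (R : realType) (n : nat).
Implicit Types (Y : R -> 'cV[R[i]]_n) (w v : 'cV[R[i]]_n).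

Lemma ReM (z1 z2 : R[i]) : complex.Re (z1 * z2) =
  complex.Re z1 * complex.Re z2 - complex.Im z1 * complex.Im z2.
Proof. by case: z1 z2 => [a b] [c d]. Qed.

Lemma ImM (z1 z2 : R[i]) : complex.Im (z1 * z2) =
  complex.Re z1 * complex.Im z2 + complex.Im z1 * complex.Re z2.
Proof. by case: z1 z2 => [a b] [c d]. Qed.

(** Each part of [M *m Y] is a real linear combination of both parts of the entries of [Y].
    Iterating this lemma gives all higher derivatives of a solution of a linear equation. *)
Lemma is_vderive_mulmx p (M : 'M[R[i]]_(p, n)) Y t w :
  is_vderive Y t w -> is_vderive (fun s => M *m Y s) t (M *m w).
Proof.
move=> dY i; split.
- have -> : (fun s => complex.Re ((M *m Y s) i 0)) =
    \sum_(j < n) (complex.Re (M i j) \*: (fun s => complex.Re (Y s j 0))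
      - complex.Im (M i j) \*: (fun s => complex.Im (Y s j 0))).
    apply/funext => s; rewrite mxE fct_sumE raddf_sum.
    by apply: eq_bigr => j _; rewrite [LHS]ReM.
  have -> : complex.Re ((M *m w) i 0) =
    \sum_(j < n) (complex.Re (M i j) *: complex.Re (w j 0)
      - complex.Im (M i j) *: complex.Im (w j 0)).
    rewrite mxE raddf_sum.
    by apply: eq_bigr => j _; rewrite [LHS]ReM.
  apply: is_derive_sum => j; have [dR dI] := dY j.
  exact: is_deriveB (is_deriveZ _ dR) (is_deriveZ _ dI).
- have -> : (fun s => complex.Im ((M *m Y s) i 0)) =
    \sum_(j < n) (complex.Re (M i j) \*: (fun s => complex.Im (Y s j 0))
      + complex.Im (M i j) \*: (fun s => complex.Re (Y s j 0))).
    apply/funext => s; rewrite mxE fct_sumE raddf_sum.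
    by apply: eq_bigr => j _; rewrite [LHS]ImM.
  have -> : complex.Im ((M *m w) i 0) =
    \sum_(j < n) (complex.Re (M i j) *: complex.Im (w j 0)
      + complex.Im (M i j) *: complex.Re (w j 0)).
    rewrite mxE raddf_sum.
    by apply: eq_bigr => j _; rewrite [LHS]ImM.
  apply: is_derive_sum => j; have [dR dI] := dY j.
  exact: is_deriveD (is_deriveZ _ dI) (is_deriveZ _ dR).
Qed.

Lemma is_vderiveB Y1 Y2 t w1 w2 : is_vderive Y1 t w1 -> is_vderive Y2 t w2 ->
  is_vderive (fun s => Y1 s - Y2 s) t (w1 - w2).
Proof.
move=> dY1 dY2 i; have [dR1 dI1] := dY1 i; have [dR2 dI2] := dY2 i; split.
- have -> : (fun s => complex.Re ((Y1 s - Y2 s) i 0)) =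
      (fun s => complex.Re (Y1 s i 0)) - (fun s => complex.Re (Y2 s i 0)).
    by apply/funext => s; rewrite !mxE raddfB.
  by rewrite !mxE raddfB; exact: is_deriveB.
- have -> : (fun s => complex.Im ((Y1 s - Y2 s) i 0)) =
      (fun s => complex.Im (Y1 s i 0)) - (fun s => complex.Im (Y2 s i 0)).
    by apply/funext => s; rewrite !mxE raddfB.
  by rewrite !mxE raddfB; exact: is_deriveB.
Qed.

Lemma is_vderive_scale (f : R -> R) (t df : R) v : is_derive t 1 f df ->
  is_vderive (fun s => (f s)%:C%C *: v) t (df%:C%C *: v).
Proof.
move=> dfE i; rewrite !mxE; case vE: (v i 0) => [a b] /=.
rewrite !mul0r subr0 addr0; split.
- have -> : (fun s => complex.Re (((f s)%:C%C *: v) i 0)) = a \*: f.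
    by apply/funext => s; rewrite mxE vE /= mul0r subr0 mulrC.
  by rewrite mulrC; exact: is_deriveZ.
- have -> : (fun s => complex.Im (((f s)%:C%C *: v) i 0)) = b \*: f.
    by apply/funext => s; rewrite mxE vE /= mul0r addr0 mulrC.
  by rewrite mulrC; exact: is_deriveZ.
Qed.

Lemma derive_continuous (f df : R -> R) (a b : R) :
  (forall t : R, is_derive t 1 f (df t)) ->
  {within `[a, b], continuous f}%classic.
Proof.
by move=> dfE; apply: derivable_within_continuous => x _; have [] := dfE x.
Qed.

Lemma derivable_bounded (f df : R -> R) (a b : R) : a <= b ->
  (forall t : R, is_derive t 1 f (df t)) ->
  exists K, forall t, a <= t <= b -> `|f t| <= K.
Proof.
move=> ab dfE; have cf := derive_continuous (a := a) (b := b) dfE.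
have [c _ fc] := EVT_max ab cf; have [d _ fd] := EVT_min ab cf.
exists (`|f c| + `|f d|) => t tab.
have tI : t \in `[a, b] by rewrite in_itv.
have := fc t tI; have := fd t tI.
have := ler_norm (f c); have := ler_norm (- f d); rewrite normrN.
have := normr_ge0 (f c); have := normr_ge0 (f d).
by move=> *; rewrite ler_norml; apply/andP; split; lra.
Qed.

Lemma mean_value_bound (f df : R -> R) (a b K : R) : a <= b ->
  (forall t : R, is_derive t 1 f (df t)) ->
  (forall t, a <= t <= b -> `|df t| <= K) -> `|f b - f a| <= K * (b - a).
Proof.
move=> ab dfE dfK; have cf := derive_continuous (a := a) (b := b) dfE.
have [c cab ->] := MVT_segment ab (fun t _ => dfE t) cf.
rewrite normrM (@ger0_norm _ (b - a)) ?subr_ge0// ler_wpM2r ?subr_ge0//.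
by apply: dfK; move: cab; rewrite in_itv.
Qed.

Lemma vderive_bounded Y Y' (a b : R) : a <= b ->
  (forall t, is_vderive Y t (Y' t)) ->
  exists K, forall t, a <= t <= b -> mnorm (Y t) <= K.
Proof.
move=> ab dY.
have /choice [K Kp] : forall i : 'I_n, exists K,
    forall t, a <= t <= b -> cnorm1 (Y t i 0) <= K.
  move=> i.
  have [K1 K1p] := derivable_bounded ab (fun t => (dY t i).1).
  have [K2 K2p] := derivable_bounded ab (fun t => (dY t i).2).
  by exists (K1 + K2) => t tab; apply: lerD; [exact: K1p|exact: K2p].
exists (\sum_i K i) => t tab; apply: ler_sum => i _; rewrite big_ord1.
exact: Kp.
Qed.

Lemma cnorm1_le_mnorm w i : cnorm1 (w i 0) <= mnorm w.
Proof.
rewrite /mnorm (bigD1 i)//= big_ord1 lerDl sumr_ge0// => j _.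
by rewrite sumr_ge0// => k _; exact: cnorm1_ge0.
Qed.

(** The mean value theorem gives a different intermediate point for each real component, so it is
    applied to the 2n real and imaginary parts separately; adding the bounds produces the factor
    2n. *)
Lemma vmean_value_bound Y Y' (a b K : R) : a <= b ->
  (forall t, is_vderive Y t (Y' t)) ->
  (forall t, a <= t <= b -> mnorm (Y' t) <= K) ->
  mnorm (Y b - Y a) <= (2 * n%:R) * K * (b - a).
Proof.
move=> ab dY Y'K.
have leR i : `|complex.Re (Y b i 0) - complex.Re (Y a i 0)| <= K * (b - a).
  apply: (mean_value_bound (f := fun t => complex.Re (Y t i 0))
    (df := fun t => complex.Re (Y' t i 0))) => // t; first by apply dY.
  move=> tab; apply: le_trans (Y'K _ tab).
  apply: le_trans (cnorm1_le_mnorm _ i).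
  by rewrite /cnorm1 lerDl.
have leI i : `|complex.Im (Y b i 0) - complex.Im (Y a i 0)| <= K * (b - a).
  apply: (mean_value_bound (f := fun t => complex.Im (Y t i 0))
    (df := fun t => complex.Im (Y' t i 0))) => // t; first by apply dY.
  move=> tab; apply: le_trans (Y'K _ tab).
  apply: le_trans (cnorm1_le_mnorm _ i).
  by rewrite /cnorm1 lerDr.
have -> : (2 * n%:R) * K * (b - a) = \sum_(i < n) (K * (b - a) + K * (b - a)).
  by rewrite sumr_const card_ord -mulr_natr; ring.
apply: ler_sum => i _; rewrite big_ord1 /cnorm1 !mxE !raddfB.
by apply: lerD; [exact: leR|exact: leI].
Qed.

End derivatives.

(** * Local error of one splitting step *)

Section splitting_step.
Variables (R : realType) (n : nat).
Implicit Types (a b : 'M[R[i]]_n) (u v w : 'cV[R[i]]_n) (s : R).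

Definition exp2mx a v : 'cV[R[i]]_n :=
  v + a *m v + (2^-1)%:C%C *: (a *m (a *m v)).

(** The factor 3 rounds up 1 + 1 + 1/2. It keeps the intermediate states of a splitting step
    comparable to [v]. *)
Lemma exp2mx_bound a v s : mnorm a <= s -> s <= 1 ->
  mnorm (exp2mx a v) <= 3 * mnorm v.
Proof.
move=> as_ s1; have a0 := mnorm_ge0 a; have v0 := mnorm_ge0 v.
have av : mnorm (a *m v) <= mnorm v.
  by rewrite (le_trans (mnormM _ _))// ler_piMl//; lra.
have aav : mnorm (a *m (a *m v)) <= mnorm v.
  by rewrite (le_trans (mnormM _ _))// (le_trans _ av)// ler_piMl ?mnorm_ge0//;
    lra.
have := mnormD (v + a *m v) ((2^-1)%:C%C *: (a *m (a *m v))).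
have := mnormD v (a *m v).
by rewrite mnormZ ger0_norm ?invr_ge0 ?ler0n// -/(exp2mx a v); lra.
Qed.

(* The relation [w - u = a (w + u) / 2] turns into
   [d = e + a (d + e) / 2 + a^3 v / 4] for [d = w - (1 + a + a^2/2) v] and
   [e = u - v], which gives stability and consistency of the step at once,
   without inverting [1 - a/2]. *)
Lemma crank_nicolson_error a u v w s : mnorm a <= s -> s <= 1 ->
  w - u = (2^-1)%:C%C *: (a *m (w + u)) ->
  mnorm (w - exp2mx a v) <= (1 + 2 * s) * mnorm (u - v) + s ^+ 3 / 2 * mnorm v.
Proof.
move=> as_ s1 stepE; have a0 := mnorm_ge0 a; have s0 : 0 <= s by lra.
set d := w - exp2mx a v; set e := u - v.
set r := a *m (a *m (a *m v)).
have dE : d = e + (2^-1)%:C%C *: (a *m (d + e)) + (4^-1)%:C%C *: r.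
  have -> : d + e = w + u - (v + v + a *m v + (2^-1)%:C%C *: (a *m (a *m v))).
    by apply/matrixP => i j; rewrite /d /e /exp2mx !mxE; ring.
  have wE : w = u + (2^-1)%:C%C *: (a *m (w + u)) by rewrite -stepE addrC subrK.
  rewrite /d /e /r {1}wE mulmxBr !mulmxDr -!scalemxAr /exp2mx.
  move: (a *m v) (a *m (a *m v)) (a *m (a *m (a *m v))) => a1 a2 a3.
  move: (a *m w) (a *m u) => aw au.
  by apply/matrixP => i j; rewrite !mxE !fmorphV !rmorph_nat; field.
have dle : mnorm d <=
    mnorm e + 2^-1 * (s * (mnorm d + mnorm e)) + 4^-1 * (s ^+ 3 * mnorm v).
  rewrite {1}dE (le_trans (mnormD _ _))// lerD//.
    rewrite (le_trans (mnormD _ _))// lerD// mnormZ.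
    rewrite ger0_norm ?invr_ge0 ?ler0n// ler_wpM2l//.
    rewrite (le_trans (mnormM _ _))// ler_pM ?mnorm_ge0//; exact: mnormD.
  rewrite mnormZ ger0_norm ?invr_ge0 ?ler0n// ler_wpM2l//.
  rewrite /r !exprS expr0 mulr1 -!mulrA.
  do 3!(rewrite (le_trans (mnormM _ _))// ler_pM ?mnorm_ge0//).
have d0 := mnorm_ge0 d; have e0 := mnorm_ge0 e; have v0 := mnorm_ge0 v.
have q0 : 0 <= s ^+ 3 * mnorm v by rewrite mulr_ge0// exprn_ge0.
rewrite [s ^+ 3 / 2]mulrC -mulrA; move: (s ^+ 3 * mnorm v) dle q0 => q dle q0.
set c := (1 + 2 * s) * mnorm e + 2^-1 * q.
(* The term in [d] on the right of [dle] is absorbed on the left. What remains follows from (1 -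
   s/2)(1 + 2s) = 1 + s/2 + s(1 - s) and (1 - s/2)/2 = 1/4 + (1 - s)/4. *)
suff : (1 - s / 2) * mnorm d <= (1 - s / 2) * c by rewrite ler_pM2l//; lra.
have sC : 0 <= 1 - s by lra.
have := mulr_ge0 e0 (mulr_ge0 s0 sC); have := mulr_ge0 q0 sC.
by rewrite /c; move: (mnorm d) (mnorm e) dle => x y dle; lra.
Qed.

Lemma mnormM_le p m q (a : 'M[R[i]]_(p, m)) (b : 'M[R[i]]_(m, q)) (x y : R) :
  mnorm a <= x -> mnorm b <= y -> mnorm (a *m b) <= x * y.
Proof.
by move=> ax b_y; rewrite (le_trans (mnormM _ _))// ler_pM ?mnorm_ge0.
Qed.

Lemma mnormD_le p m (a b : 'M[R[i]]_(p, m)) (x y : R) :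
  mnorm a <= x -> mnorm b <= y -> mnorm (a + b) <= x + y.
Proof. by move=> ax b_y; rewrite (le_trans (mnormD _ _))// lerD. Qed.

(* The symmetric composition matches the quadratic Taylor polynomial of the
   exponential of [a + b + a] because [a^2 + a^2 + b^2 + 2 (a b + b a + a a)]
   is [(a + b + a)^2]. *)
Lemma strang_exp2mx_error a b v s : mnorm a <= s -> mnorm b <= s -> s <= 1 ->
  mnorm (exp2mx a (exp2mx b (exp2mx a v)) - exp2mx (a + b + a) v)
    <= 13 * s ^+ 3 * mnorm v.
Proof.
move=> as_ bs s1.
have a0 := mnorm_ge0 a; have s0 : 0 <= s by lra.
have v0 := mnorm_ge0 v.
have norm_half p (c : 'M[R[i]]_(p, 1)) x : mnorm c <= x ->
    mnorm ((2^-1)%:C%C *: c) <= 2^-1 * x.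
  by move=> cx; rewrite mnormZ ger0_norm ?invr_ge0 ?ler0n// ler_wpM2l.
set h : R[i] := (2^-1)%:C%C.
(* [p] and [q] are the two quadratic polynomials minus the identity, and [p2], [q2] are their
   quadratic parts. Expanding in these makes the order of each term in [s] visible. *)
pose p2 u := h *: (a *m (a *m u)); pose q2 u := h *: (b *m (b *m u)).
pose p u := a *m u + p2 u; pose q u := b *m u + q2 u.
have normp2 u (x : R) : mnorm u <= x -> mnorm (p2 u) <= s ^+ 2 / 2 * x.
  move=> ux; rewrite /p2.
  rewrite (le_trans (norm_half _ _ _ (mnormM_le as_ (mnormM_le as_ ux))))//.
  by rewrite expr2; lra.
have normq2 u (x : R) : mnorm u <= x -> mnorm (q2 u) <= s ^+ 2 / 2 * x.
  move=> ux; rewrite /q2.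
  rewrite (le_trans (norm_half _ _ _ (mnormM_le bs (mnormM_le bs ux))))//.
  by rewrite expr2; lra.
have pD x y : p (x + y) = p x + p y.
  by rewrite /p /p2 !mulmxDr scalerDr addrACA.
have qD x y : q (x + y) = q x + q y.
  by rewrite /q /q2 !mulmxDr scalerDr addrACA.
have aE u : exp2mx a u = u + p u by rewrite /exp2mx /p addrA.
have bE u : exp2mx b u = u + q u by rewrite /exp2mx /q addrA.
have pE u : p u = a *m u + p2 u by exact: erefl.
have qE u : q u = b *m u + q2 u by exact: erefl.
have p2E u : p2 u = h *: (a *m (a *m u)) by exact: erefl.
have q2E u : q2 u = h *: (b *m (b *m u)) by exact: erefl.
clearbody p q p2 q2.
(* All terms of order at most two cancel; every summand left contains at least three factors [a] or
   [b]. *)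
have remE : exp2mx a (exp2mx b (exp2mx a v)) - exp2mx (a + b + a) v =
  (a *m p2 v + p2 (p v)) + (b *m p2 v + q2 (p v)) + (a *m q2 v + p2 (q v))
  + p (q (p v)).
  have ppE : p (p v) = a *m (a *m v) + a *m p2 v + p2 (p v).
    by rewrite [LHS]pE {1}(pE v) mulmxDr.
  have qpE : q (p v) = b *m (a *m v) + b *m p2 v + q2 (p v).
    by rewrite [LHS]qE {1}(pE v) mulmxDr.
  have pqE : p (q v) = a *m (b *m v) + a *m q2 v + p2 (q v).
    by rewrite [LHS]pE {1}(qE v) mulmxDr.
  rewrite !aE bE !(pD, qD) ppE pqE; move: (p (q (p v))) => pqpv; rewrite qpE.
  move: (p2 (p v)) (q2 (p v)) (p2 (q v)) => x1 x2 x3.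
  move: (a *m p2 v) (b *m p2 v) (a *m q2 v) => x4 x5 x6.
  rewrite pE qE p2E q2E /exp2mx !(mulmxDl, mulmxDr).
  move: (a *m (a *m v)) (a *m (b *m v)) (b *m (a *m v)) (b *m (b *m v)).
  move: (a *m v) (b *m v) => x7 x8 x9 x10 x11 x12.
  apply/matrixP => i j; rewrite !mxE /h !fmorphV !rmorph_nat.
  by field.
have normp u x : mnorm u <= x -> mnorm (p u) <= 2 * s * x.
  move=> ux; have x0 := le_trans (mnorm_ge0 u) ux.
  rewrite pE; apply: le_trans (mnormD_le (mnormM_le as_ ux) (normp2 _ _ ux)) _.
  have -> : s * x + s ^+ 2 / 2 * x = (s + s * s / 2) * x by field.
  by rewrite ler_wpM2r//; nra.
have normq u x : mnorm u <= x -> mnorm (q u) <= 2 * s * x.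
  move=> ux; have x0 := le_trans (mnorm_ge0 u) ux.
  rewrite qE; apply: le_trans (mnormD_le (mnormM_le bs ux) (normq2 _ _ ux)) _.
  have -> : s * x + s ^+ 2 / 2 * x = (s + s * s / 2) * x by field.
  by rewrite ler_wpM2r//; nra.
have vv : mnorm v <= mnorm v by [].
have pv := normp _ _ vv; have qv := normq _ _ vv.
have p2v := normp2 _ _ vv; have q2v := normq2 _ _ vv.
rewrite remE.
(* Each of the three pairs contributes (1/2 + 1) s^3 and the triple composition (2s)^3, so the total
   factor 12.5 is rounded up to 13. *)
apply: le_trans (mnormD_le (mnormD_le (mnormD_le
  (mnormD_le (mnormM_le as_ p2v) (normp2 _ _ pv))
  (mnormD_le (mnormM_le bs p2v) (normq2 _ _ pv)))
  (mnormD_le (mnormM_le as_ q2v) (normp2 _ _ qv)))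
  (normp _ _ (normq _ _ pv))) _.
have := mulr_ge0 (exprn_ge0 3 s0) v0; move: (mnorm v) => x ?.
by lra.
Qed.

(** The Crank-Nicolson estimate is chained along the Taylor states [z1] and [z2] issued from [v],
    and the consistency error of the symmetric composition is added at the end. *)
Lemma splitting_step_error a b u v w1 w2 w3 s :
  mnorm a <= s -> mnorm b <= s -> s <= 1 ->
  w1 - u = (2^-1)%:C%C *: (a *m (w1 + u)) ->
  w2 - w1 = (2^-1)%:C%C *: (b *m (w2 + w1)) ->
  w3 - w2 = (2^-1)%:C%C *: (a *m (w3 + w2)) ->
  mnorm (w3 - exp2mx (a + b + a) v)
    <= (1 + 26 * s) * mnorm (u - v) + 27 * s ^+ 3 * mnorm v.
Proof.
move=> as_ bs s1 step1 step2 step3.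
have s0 : 0 <= s by have := mnorm_ge0 a; lra.
set z1 := exp2mx a v; set z2 := exp2mx b z1.
have le1 := crank_nicolson_error v as_ s1 step1.
have le2 := crank_nicolson_error z1 bs s1 step2.
have le3 := crank_nicolson_error z2 as_ s1 step3.
have lez1 : mnorm z1 <= 3 * mnorm v := exp2mx_bound v as_ s1.
have lez2 : mnorm z2 <= 3 * mnorm z1 := exp2mx_bound z1 bs s1.
have leS := strang_exp2mx_error v as_ bs s1.
have -> : w3 - exp2mx (a + b + a) v =
    (w3 - exp2mx a z2) + (exp2mx a z2 - exp2mx (a + b + a) v).
  by rewrite addrA subrK.
apply: le_trans (mnormD_le le3 leS) _.
rewrite -/z1 in le1; rewrite -/z2 in le2.
have c0 : 0 <= s ^+ 3 by exact: exprn_ge0.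
have e0 := mnorm_ge0 (u - v); have v0 := mnorm_ge0 v.
move: (s ^+ 3) c0 le1 le2 {le3 leS} => c c0 le1 le2.
clearbody z2; clearbody z1.
move: (mnorm (w1 - z1)) (mnorm (w2 - z2)) (mnorm (u - v)) (mnorm z1) (mnorm z2)
  (mnorm v) le1 le2 lez1 lez2 e0 v0 => d1 d2 e y1 y2 x le1 le2 lez1 lez2 e0 v0.
set g := 1 + 2 * s in le1 le2 *.
have g0 : 0 <= g by rewrite /g; lra.
have g3 : g <= 3 by rewrite /g; lra.
have cx : 0 <= c * x by exact: mulr_ge0.
have le1' : g * (g * d1) <= g * (g * (g * e + c / 2 * x)).
  by do 2!apply: ler_wpM2l => //.
have le2' : g * d2 <= g * (g * d1 + c / 2 * y1) by exact: ler_wpM2l.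
have y1' : c * y1 <= 3 * (c * x) by have := ler_wpM2l c0 lez1; lra.
have y2' : c * y2 <= 9 * (c * x) by have := ler_wpM2l c0 lez2; lra.
have gy1 : g * (c * y1) <= 9 * (c * x).
  apply: le_trans (ler_wpM2l g0 y1') _; rewrite mulrCA.
  by have := ler_wpM2r cx g3; lra.
have ggcx : g * (g * (c * x)) <= 9 * (c * x).
  have gcx : g * (c * x) <= 3 * (c * x) by exact: ler_wpM2r.
  by have := ler_wpM2l g0 gcx; lra.
(* Since s^2 and s^3 are at most s, (1 + 2s)^3 is at most 1 + (6 + 12 + 8) s. *)
have g3e : g * (g * (g * e)) <= (1 + 26 * s) * e.
  rewrite !mulrA ler_wpM2r// /g.
  have ss : s * s <= s by rewrite ler_piMl.
  have sss : s * s * s <= s.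
    by apply: le_trans ss; rewrite ler_piMr// mulr_ge0.
  by lra.
(* Each substep contributes at most 9/2 to the coefficient of s^3; with the 13 of the composition
   this gives 26.5, rounded up to 27. *)
lra.
Qed.
End splitting_step.

(** * Taylor expansion of the exact flow *)

Section evolution.
Variables (R : realType) (n : nat).
Implicit Types (Y : R -> 'cV[R[i]]_n) (A M : 'M[R[i]]_n) (u w : 'cV[R[i]]_n).

(** The third derivative is bounded on [0, T], and three successive mean value estimates carry this
    bound down to [Y], each costing a factor 2n and gaining a factor [h]. *)
Lemma evolution_taylor A Y (T : R) : 0 <= T ->
  (forall t, is_vderive Y t (A *m Y t)) ->
  exists2 K, 0 <= K & forall t h : R, 0 <= t -> 0 <= h -> t + h <= T ->
    mnorm (Y (t + h) - exp2mx (h%:C%C *: A) (Y t)) <= K * h ^+ 3.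
Proof.
move=> T0 dY.
pose Y1 t := A *m Y t; pose Y2 t := A *m Y1 t; pose Y3 t := A *m Y2 t.
have dY0 t : is_vderive Y t (Y1 t) by exact: dY.
have dY1 t : is_vderive Y1 t (Y2 t) by exact: is_vderive_mulmx.
have dY2 t : is_vderive Y2 t (Y3 t) by exact: is_vderive_mulmx.
have dY3 t : is_vderive Y3 t (A *m Y3 t) by exact: is_vderive_mulmx.
have Y1E t : A *m Y t = Y1 t by exact: erefl.
have Y2E t : A *m Y1 t = Y2 t by exact: erefl.
clearbody Y3; clearbody Y2; clearbody Y1.
(* The derivative of [Y3] serves only to make [Y3] continuous, hence bounded on the compact
   interval. *)
have [K0 K0p] := vderive_bounded T0 dY3.
have K00 : 0 <= K0 by rewrite (le_trans _ (K0p 0 _)) ?mnorm_ge0// lexx.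
pose c : R := 2 * n%:R; have c0 : 0 <= c by rewrite mulr_ge0.
exists (c * (c * (c * K0))); first by rewrite !mulr_ge0.
move=> t h t0 h0 thT.
have dlin (s : R) : is_derive s 1 (fun s : R => s - t) 1.
  by rewrite -[X in is_derive _ _ _ X]subr0; apply: is_deriveB.
have dsqr (s : R) : is_derive s 1 (fun s : R => 2^-1 * (s - t) ^+ 2) (s - t).
  have := is_deriveZ 2^-1 (is_deriveX 2 (dlin s)).
  move=> /(@is_derive_eq _ _ _ _ _ _ _ _); apply.
  rewrite -[LHS]/(2^-1 * (2 * (s - t) * 1)).
  by field.
have le2 (s : R) : t <= s <= t + h -> mnorm (Y2 s - Y2 t) <= c * K0 * h.
  move=> /andP[ts sth].
  have := vmean_value_bound (K := K0) ts dY2.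
  move=> /(_ _)/le_trans; apply.
    by move=> x /andP[tx xs]; apply: K0p; apply/andP; split; lra.
  by rewrite ler_wpM2l ?mulr_ge0//; lra.
have le1 (s : R) : t <= s <= t + h ->
    mnorm (Y1 s - Y1 t - (s - t)%:C%C *: Y2 t) <= c * (c * K0 * h) * h.
  move=> /andP[ts sth].
  have := vmean_value_bound (K := c * K0 * h) ts
    (fun s => is_vderiveB (dY1 s) (is_vderive_scale (Y2 t) (dlin s))).
  rewrite (subrr t) scale0r subr0 addrAC => /(_ _)/le_trans; apply.
    move=> x /andP[tx xs]; rewrite scale1r.
    by apply: le2; apply/andP; split; lra.
  by rewrite ler_wpM2l ?mulr_ge0//; lra.
have th : t <= t + h by lra.
(* The function is Y(s) - (s - t) Y1(t) - (s - t)^2/2 Y2(t): its derivative is controlled by [le1],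
   and its increment from t to t + h is the Taylor remainder. *)
have := vmean_value_bound (K := c * (c * K0 * h) * h) th
  (fun s => is_vderiveB (is_vderiveB (dY0 s) (is_vderive_scale (Y1 t) (dlin s)))
                        (is_vderive_scale (Y2 t) (dsqr s))).
rewrite (subrr t) expr0n mulr0 !scale0r !subr0 [t + h - t]addrC addKr.
move=> /(_ _)/le_trans le0.
have -> : Y (t + h) - exp2mx (h%:C%C *: A) (Y t) =
    Y (t + h) - h%:C%C *: Y1 t - (2^-1 * h ^+ 2)%:C%C *: Y2 t - Y t.
  rewrite /exp2mx -!scalemxAl -!scalemxAr Y1E Y2E !scalerA.
  rewrite -!rmorphM expr2 mulrA.
  by apply/matrixP => i j; rewrite !mxE; ring.
apply: le0.
  by move=> x txh; rewrite scale1r; exact: le1.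
by rewrite -/c; lra.
Qed.

(** Clears the division by [h] and absorbs -ih into the matrix, which is the form used by the local
    error estimates. *)
Lemma cn_stepE (h : R) M u w : h != 0 -> cn_step h M u w ->
  w - u = (2^-1)%:C%C *: ((h%:C%C *: (- 'i *: M)) *m (w + u)).
Proof.
move=> h0 stepE.
have -> : w - u = h%:C%C *: ((h^-1)%:C%C *: (w - u)).
  by rewrite scalerA -rmorphM mulfV// scale1r.
rewrite stepE -!scalemxAl -scalemxAr !scalerA fmorphV rmorph_nat.
by congr (_ *: _); ring.
Qed.

End evolution.

(** * Accumulation of local errors over [0, T] *)

Lemma discrete_gronwall (R : realType) (e : nat -> R) (g q : R) m :
  1 <= g -> 0 <= q -> e 0%N = 0 ->
  (forall k, (k < m)%N -> e k.+1 <= g * e k + q) -> e m <= m%:R * g ^+ m * q.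
Proof.
move=> g1 q0 e0 eS; have g0 : 0 <= g by lra.
(* Unrolling the recursion gives a geometric sum of k terms, each at most g^k q. The recursion is
   available only below [m], because the local bounds hold only up to the final time. *)
suff le k : (k <= m)%N -> e k <= k%:R * g ^+ k * q by exact: le.
elim: k => [_|k IH km]; first by rewrite e0 !mul0r.
apply: le_trans (eS _ km) _.
have := ler_wpM2l g0 (IH (ltnW km)).
have : q <= g ^+ k.+1 * q by rewrite ler_peMl// exprn_ege1.
by rewrite -natr1 exprS; lra.
Qed.

Lemma splitting_convergence (R : realType) n (A B : 'M[R[i]]_n) (T : R)
    (Phi : R -> 'cV[R[i]]_n) :
  0 < T -> (forall t, is_vderive Phi t ((A + B) *m Phi t)) ->
  exists tau0 C : R, [/\ 0 < tau0, 0 < C &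
    forall tau : R, 0 < tau < tau0 ->
    forall Psi : nat -> 'cV[R[i]]_n, Psi 0%N = Phi 0 ->
    (forall k, exists w1 w2, [/\
      w1 - Psi k =
        (2^-1)%:C%C *: (((tau / 2)%:C%C *: A) *m (w1 + Psi k)),
      w2 - w1 = (2^-1)%:C%C *: ((tau%:C%C *: B) *m (w2 + w1)) &
      Psi k.+1 - w2 =
        (2^-1)%:C%C *: (((tau / 2)%:C%C *: A) *m (Psi k.+1 + w2))]) ->
    forall k : nat, k%:R * tau <= T ->
    mnorm (Phi (k%:R * tau) - Psi k) <= C * tau ^+ 2].
Proof.
move=> T0 dPhi.
have [K K0 taylor] := evolution_taylor (ltW T0) dPhi.
have [W Phi_le] := vderive_bounded (ltW T0) dPhi.
have W0 : 0 <= W by rewrite (le_trans _ (Phi_le 0 _)) ?mnorm_ge0// lexx ltW.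
(* The added 1 makes the common bound positive, so that [kap^-1] can serve as [tau0]; then
   [s = kap * tau] is at most 1, as the step estimates require. *)
have [kap [kap0 leA leB]] :
    exists kap, [/\ 0 < kap, mnorm A <= kap & mnorm B <= kap].
  have A0 := mnorm_ge0 A; have B0 := mnorm_ge0 B.
  by exists (mnorm A + mnorm B + 1); split; lra.
(* The coefficient of tau^3 in the local error: the splitting part along the exact solution, bounded
   by [W], plus the Taylor remainder of the flow. *)
pose q := 27 * kap ^+ 3 * W + K.
have q0 : 0 <= q by rewrite addr_ge0// !mulr_ge0// ?exprn_ge0// ltW.
pose L := 26 * kap; have L0 : 0 <= L by rewrite mulr_ge0// ltW.
pose C := T * expR (L * T) * q.
have C0 : 0 <= C by rewrite !mulr_ge0 ?expR_ge0// ltW.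
(* [C] is only known to be nonnegative, so 1 is added to get a positive constant. *)
exists kap^-1, (C + 1); split; [by rewrite invr_gt0|by lra|].
move=> tau /andP[tau0 tau_lt] Psi Psi0 step k ktau.
have tau_ge0 := ltW tau0.
have s1 : kap * tau <= 1 by rewrite -ler_pdivlMl// mulr1 ltW.
set a := (tau / 2)%:C%C *: A in step; set b := tau%:C%C *: B in step.
have a_le : mnorm a <= kap * tau.
  rewrite mnormZ ger0_norm ?divr_ge0// mulrC.
  have := ler_wpM2r tau_ge0 leA; have := mulr_ge0 (ltW kap0) tau_ge0; lra.
have b_le : mnorm b <= kap * tau by rewrite mnormZ ger0_norm// mulrC ler_wpM2r.
have abE : a + b + a = tau%:C%C *: (A + B).
  by rewrite /a /b addrAC -scalerDl -rmorphD -splitr -scalerDr.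
clearbody a b.
pose e j := mnorm (Psi j - Phi (j%:R * tau)).
have eS j : (j < k)%N -> e j.+1 <= (1 + L * tau) * e j + q * tau ^+ 3.
  move=> jk; have tS : j%:R * tau + tau = j.+1%:R * tau.
    by rewrite -natr1 mulrDl mul1r.
  have jtau : j%:R * tau + tau <= T.
    by apply: le_trans ktau; rewrite tS ler_pM2r// ler_nat.
  have j0 : 0 <= j%:R * tau by rewrite mulr_ge0// ltW.
  have Phi_j : mnorm (Phi (j%:R * tau)) <= W.
    by apply: Phi_le; apply/andP; split; lra.
  have c0 : 0 <= 27 * (kap * tau) ^+ 3.
    by rewrite mulr_ge0// exprn_ge0// mulr_ge0// ltW.
  have {}Phi_j := ler_wpM2l c0 Phi_j.
  have [w1 [w2 [step1 step2 step3]]] := step j.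
  have := splitting_step_error (Phi (j%:R * tau)) a_le b_le s1
    step1 step2 step3.
  have := taylor _ _ j0 (ltW tau0) jtau.
  rewrite -abE tS.
  rewrite /e; set z := exp2mx _ _ => le1 le2.
  (* The numerical and exact solutions are both compared with [z], the Taylor polynomial started
     from the exact value at the previous time. *)
  have -> : Psi j.+1 - Phi (j.+1%:R * tau) =
      (Psi j.+1 - z) - (Phi (j.+1%:R * tau) - z) by rewrite opprB addrA subrK.
  apply: le_trans (mnormB _ _) _; apply: le_trans (lerD le2 le1) _.
  by rewrite /q /L; lra.
have e_le : e k <= k%:R * (1 + L * tau) ^+ k * (q * tau ^+ 3).
  apply: discrete_gronwall eS.
  - by rewrite lerDl mulr_ge0// ltW.
  - by rewrite mulr_ge0// exprn_ge0// ltW.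
  - by rewrite /e mul0r Psi0 subrr mnorm0.
rewrite -mnormN opprB; apply: le_trans e_le _.
have exp_le : (1 + L * tau) ^+ k <= expR (L * T).
  apply: (@le_trans _ _ (expR (L * tau) ^+ k)).
    rewrite lerXn2r ?nnegrE ?expR_ge0 ?expR_ge1Dx//.
    by rewrite addr_ge0// mulr_ge0.
  by rewrite -expRM_natl ler_expR mulrCA ler_wpM2l.
(* One factor [tau] is paired with the number of steps, as [k * tau] is at most [T]; this leaves
   second order. *)
have -> : k%:R * (1 + L * tau) ^+ k * (q * tau ^+ 3) =
  k%:R * tau * (1 + L * tau) ^+ k * q * tau ^+ 2 by ring.
apply: ler_wpM2r; first exact: exprn_ge0.
apply: (@le_trans _ _ C); last by lra.
apply: ler_wpM2r => //; apply: ler_pM => //; first exact: mulr_ge0.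
by rewrite exprn_ge0// addr_ge0// mulr_ge0.
Qed.

(** * Application to the Hamiltonian matrix *)

Lemma splitting_error (R : realType) n (D V1 V2 : 'M[R[i]]_n) (T : R)
    (Phi0 : 'cV[R[i]]_n) (Phi : R -> 'cV[R[i]]_n) :
  0 < T -> evolution (D + V1 + V2) Phi0 Phi ->
  exists tau0 C : R, [/\ 0 < tau0, 0 < C &
    forall tau : R, 0 < tau < tau0 ->
    forall Psi : nat -> 'cV[R[i]]_n, cn_splitting D V1 V2 tau Phi0 Psi ->
    forall k : nat, k%:R * tau <= T ->
    mnorm (Phi (k%:R * tau) - Psi k) <= C * tau ^+ 2].
Proof.
move=> T0 [Phi00 dPhi].
(* Sharing the diagonal part equally between the two generators makes them add up to -iH. *)
have HE : - 'i *: (D + V1 + V2) =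
    - 'i *: (2^-1 *: D + V1) + - 'i *: (2^-1 *: D + V2).
  by apply/matrixP => i j; rewrite !mxE; field.
have dPhi' t : is_vderive Phi t
    ((- 'i *: (2^-1 *: D + V1) + - 'i *: (2^-1 *: D + V2)) *m Phi t).
  by rewrite -HE -scalemxAl; exact: dPhi.
have [tau0 [C [tau0_gt0 C_gt0 err]]] := splitting_convergence T0 dPhi'.
exists tau0, C; split => // tau tauI Psi [Psi0 step] k kT.
have tau_neq0 : tau != 0 by case/andP: tauI => ? _; rewrite gt_eqF.
have htau_neq0 : tau / 2 != 0 by rewrite mulf_neq0// invr_neq0.
apply: err => //; first by rewrite Psi0 Phi00.
move=> j; have [w1 [w2 [step1 step2 step3]]] := step j.
by exists w1, w2; split; apply: cn_stepE.
Qed.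

Theorem theorem4p3 (R : realType) (d : nat) (hd : d = 1%N \/ d = 2%N)
    (A1 A2 : 'M[R]_d) (hA1 : A1 \in unitmx) (hA2 : A2 \in unitmx)
    (hA : incommensurate A1 A2)
    (v1 v2 : 'cV[R]_d -> R)
    (hv1 : L2loc v1) (hp1 : lattice_periodic A1 v1)
    (hv2 : L2loc v2) (hp2 : lattice_periodic A2 v2)
    (Ec T : R) (hEc : 0 < Ec) (hT : 0 < T)
    (Phi0 : 'cV[R[i]]_(pw_dim A1 A2 Ec))
    (Phi : R -> 'cV[R[i]]_(pw_dim A1 A2 Ec))
    (hPhi : evolution (pwH A1 A2 v1 v2 Ec) Phi0 Phi) :
  exists tau0 C : R, [/\ 0 < tau0, 0 < C &
    forall tau : R, 0 < tau < tau0 ->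
    forall Psi : nat -> 'cV[R[i]]_(pw_dim A1 A2 Ec),
    cn_splitting (pwD A1 A2 Ec) (pwV1 A1 A2 v1 Ec) (pwV2 A1 A2 v2 Ec)
      tau Phi0 Psi ->
    forall k : nat, k%:R * tau <= T ->
    l2norm (Phi (k%:R * tau) - Psi k) <= C * tau ^+ 2].
Proof.
have [tau0 [C [tau0_gt0 C_gt0 err]]] := splitting_error hT hPhi.
exists tau0, C; split => // tau tauI Psi PsiE k kT.
exact: le_trans (l2norm_le_mnorm _) (err tau tauI Psi PsiE k kT).
Qed.
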